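(* Let $\lambda>0$, $0<\phi<\pi$, $x\in\mathbb C$, let $y_0,y_1\in\mathbb C$ be given, and let $\{y_n\}_{n\ge0}$ be generated by $$2[x\sin\phi+(n+\lambda)\cos\phi]\,y_n=(n+1)y_{n+1}+(n+2\lambda-1)y_{n-1},\qquad n\ge1 .$$ Then $Y(t)=\sum_{n=0}^\infty y_nt^n$ satisfies, for $|t|<1$, $$(1-te^{i\phi})^{\lambda-ix}(1-te^{-i\phi})^{\lambda+ix}\,Y(t)=y_0+\left[y_1-2x\sin\phi\,y_0-2\lambda\cos\phi\,y_0\right]\int_0^t(1-ue^{i\phi})^{\lambda-ix-1}(1-ue^{-i\phi})^{\lambda+ix-1}\,du .$$
   Context: Powers are principal branches. The recurrence is the three-term recurrence of the Meixner--Pollaczek polynomials. *)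

(* Defs.v *)
(* Stdlib real numbers with Coquelicot's complex numbers, series and integrals. *)
From Stdlib Require Export Reals.
From Coquelicot Require Export Coquelicot.
Local Open Scope R_scope.

Definition Cexp (z : C) : C :=
  (exp (Re z) * cos (Im z), exp (Re z) * sin (Im z)).

(* Principal argument, with values in (-PI, PI]; the negative real axis gets
   PI.  The value at 0 is meaningless. *)
Definition Carg (z : C) : R :=
  if Rle_dec 0 (Im z) then acos (Re z / Cmod z) else - acos (Re z / Cmod z).

Definition Clog (z : C) : C := (ln (Cmod z), Carg z).

(* Principal branch of z^w; only meaningful for z <> 0. *)
Definition Cpower (z w : C) : C := Cexp (Cmult w (Clog z)).

(* I is the integral of f along the straight segment from a to b.  For f
   holomorphic on a disc containing a and b, this is the integral along any
   path from a to b in that disc. *)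
Definition is_CInt (f : C -> C) (a b : C) (I : C) : Prop :=
  @is_RInt C_R_NormedModule
    (fun s : R => Cmult (Cminus b a) (f (Cplus a (Cmult s (Cminus b a)))))
    0 1 I.

(* Main.v *)
(* The recurrence says that Y solves a first-order linear differential equation
   whose integrating factor is (1 - t e^{i phi})^{lambda - i x}
   (1 - t e^{-i phi})^{lambda + i x}; integrating it along the segment [0, t]
   gives the formula.  Convergence in the unit disc comes from viewing the
   recurrence as an O(1/n) perturbation of the constant-coefficient one with
   characteristic roots e^{i phi} and e^{-i phi}, which are distinct (as
   0 < phi < pi) and unimodular. *)
From Stdlib Require Import Lra Lia.
Require Import Defs.
Open Scope R_scope.
Open Scope C_scope.

(** * Principal logarithm and powers on the right half-plane *)

Lemma Cexp_0 : Cexp 0 = 1.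
Proof.
unfold Cexp; simpl; rewrite exp_0, cos_0, sin_0.
apply injective_projections; simpl; ring.
Qed.

Lemma Cexp_plus (z w : C) : Cexp (z + w) = Cexp z * Cexp w.
Proof.
destruct z as [a b], w as [c d]; unfold Cexp; simpl.
rewrite exp_plus, cos_plus, sin_plus; apply injective_projections; simpl; ring.
Qed.

(** Puts the modulus in the shape in which [cos_atan] and [sin_atan] express the cosine and sine of
    an arctangent. *)
Lemma Cmod_sqrt_ratio (z : C) : (0 < Re z)%R ->
  Cmod z = (Re z * sqrt (1 + (Im z / Re z)²))%R.
Proof.
destruct z as [a b]; unfold Cmod, Rsqr; simpl; intros Ha.
replace (a * (a * 1) + b * (b * 1))%R with (a * a * (1 + b / a * (b / a)))%R by (field; lra).
rewrite sqrt_mult_alt by nra. now rewrite sqrt_square by lra.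
Qed.

(** On the right half-plane the two-case arccosine becomes a single smooth expression, which can be
    differentiated across the real axis. The bases [1 - s t e^(+-i phi)] with [|t| < 1] and
    [0 <= s <= 1] all lie there. *)
Lemma Carg_atan (z : C) : (0 < Re z)%R -> Carg z = atan (Im z / Re z).
Proof.
intros Hz; unfold Carg.
assert (Hs : (0 < sqrt (1 + (Im z / Re z)²))%R)
  by (apply sqrt_lt_R0; generalize (Rle_0_sqr (Im z / Re z)); lra).
assert (E : (Re z / Cmod z)%R = cos (atan (Im z / Re z))).
{ rewrite cos_atan, Cmod_sqrt_ratio by assumption. field; lra. }
rewrite E. generalize (atan_bound (Im z / Re z)); intros B.
assert (HR : (0 < / Re z)%R) by now apply Rinv_0_lt_compat.
destruct (Rle_dec 0 (Im z)) as [Hi|Hi].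
- apply acos_cos; split; [|lra].
  rewrite <- atan_0. destruct (Rle_lt_or_eq_dec 0 (Im z / Re z)) as [H|H].
  + apply Rmult_le_pos; lra.
  + left; now apply atan_increasing.
  + rewrite <- H; lra.
(* Below the real axis the arctangent is negative: [acos] returns its opposite, and the sign in
   [Carg] undoes this. *)
- rewrite <- cos_neg, acos_cos; [lra|]. split; [|lra].
  assert (atan (Im z / Re z) < atan 0)%R.
  { apply atan_increasing. unfold Rdiv; nra. }
  rewrite atan_0 in H; lra.
Qed.

Lemma Cexp_Clog (z : C) : (0 < Re z)%R -> Cexp (Clog z) = z.
Proof.
intros Hz; unfold Cexp, Clog; simpl.
assert (Hs : (0 < sqrt (1 + (Im z / Re z)²))%R)
  by (apply sqrt_lt_R0; generalize (Rle_0_sqr (Im z / Re z)); lra).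
rewrite Carg_atan, cos_atan, sin_atan, Cmod_sqrt_ratio by assumption.
rewrite exp_ln by now apply Rmult_lt_0_compat.
apply injective_projections; simpl; unfold Re, Im in *; field; lra.
Qed.

Lemma Cpower_1_l (w : C) : Cpower 1 w = 1.
Proof.
unfold Cpower, Clog.
rewrite Carg_atan by (simpl; lra).
rewrite Cmod_1, ln_1; simpl.
replace (0 / 1)%R with 0%R by field. rewrite atan_0.
rewrite Cmult_0_r. apply Cexp_0.
Qed.

Lemma Cpower_minus_1 (z w : C) : (0 < Re z)%R ->
  Cpower z w = Cpower z (w - 1) * z.
Proof.
intros Hz; unfold Cpower.
rewrite <- (Cexp_Clog z) at 3 by assumption.
rewrite <- Cexp_plus; f_equal; ring.
Qed.

(** * Derivatives of complex functions of a real variable *)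

Lemma is_derive_eq (f : R -> R) (s l l' : R) : l = l' -> is_derive f s l -> is_derive f s l'.
Proof. now intros <-. Qed.

(** A real parameter suffices because everything is restricted to the segment from 0 to [t];
    splitting into components gives access to real calculus. *)
Definition is_Cderive (f : R -> C) (s : R) (l : C) : Prop :=
  is_derive (fun r => Re (f r)) s (Re l) /\ is_derive (fun r => Im (f r)) s (Im l).

Lemma is_Cderive_eq (f : R -> C) (s : R) (l l' : C) :
  is_Cderive f s l -> l = l' -> is_Cderive f s l'.
Proof. now intros H <-. Qed.

Lemma is_Cderive_ext (f g : R -> C) (s : R) (l : C) :
  (forall r, f r = g r) -> is_Cderive f s l -> is_Cderive g s l.
Proof.
intros E [H1 H2]; split; eapply is_derive_ext; try eassumption;
intros r; simpl; now rewrite E.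
Qed.

Lemma is_Cderive_const (c : C) (s : R) : is_Cderive (fun _ => c) s 0.
Proof. split; apply (is_derive_const (V := R_NormedModule)). Qed.

Lemma is_Cderive_RtoC (s : R) : is_Cderive RtoC s 1.
Proof.
split; simpl; [apply (is_derive_id s) | exact (is_derive_const (V := R_NormedModule) 0%R s)].
Qed.

Lemma is_Cderive_plus (f g : R -> C) (s : R) (l m : C) :
  is_Cderive f s l -> is_Cderive g s m -> is_Cderive (fun r => f r + g r) s (l + m).
Proof.
intros [F1 F2] [G1 G2]; split.
- exact (is_derive_plus (V := R_NormedModule) _ _ _ _ _ F1 G1).
- exact (is_derive_plus (V := R_NormedModule) _ _ _ _ _ F2 G2).
Qed.

Lemma is_Cderive_mult (f g : R -> C) (s : R) (l m : C) :
  is_Cderive f s l -> is_Cderive g s m ->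
  is_Cderive (fun r => f r * g r) s (l * g s + f s * m).
Proof.
intros [F1 F2] [G1 G2]; split.
- generalize (is_derive_minus (V := R_NormedModule) _ _ _ _ _
    (is_derive_mult _ _ _ _ _ F1 G1 Rmult_comm) (is_derive_mult _ _ _ _ _ F2 G2 Rmult_comm)).
  apply is_derive_eq; simpl; unfold Re, Im, minus, plus, opp, mult; simpl; ring.
- generalize (is_derive_plus (V := R_NormedModule) _ _ _ _ _
    (is_derive_mult _ _ _ _ _ F1 G2 Rmult_comm) (is_derive_mult _ _ _ _ _ F2 G1 Rmult_comm)).
  apply is_derive_eq; simpl; unfold Re, Im, minus, plus, opp, mult; simpl; ring.
Qed.

Lemma is_Cderive_Cexp (f : R -> C) (s : R) (l : C) :
  is_Cderive f s l -> is_Cderive (fun r => Cexp (f r)) s (l * Cexp (f s)).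
Proof.
intros [F1 F2]; split; simpl.
- generalize (is_derive_mult _ _ _ _ _ (is_derive_comp exp _ _ _ _ (is_derive_exp _) F1)
   (is_derive_comp cos _ _ _ _ (is_derive_cos _) F2) Rmult_comm).
  apply is_derive_eq; unfold Re, Im, plus, mult, scal; simpl; unfold mult; simpl; ring.
- generalize (is_derive_mult _ _ _ _ _ (is_derive_comp exp _ _ _ _ (is_derive_exp _) F1)
   (is_derive_comp sin _ _ _ _ (is_derive_sin _) F2) Rmult_comm).
  apply is_derive_eq; unfold Re, Im, plus, mult, scal; simpl; unfold mult; simpl; ring.
Qed.

(** The value is the real part of [(a + i b) / (u + i v)], as the logarithmic derivative requires;
    its imaginary part appears in the companion lemma for the arctangent. *)
Lemma is_derive_ln_sqrt_sum_squares (u v : R -> R) (s a b : R) : (0 < u s)%R ->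
  is_derive u s a -> is_derive v s b ->
  is_derive (fun r => ln (sqrt (u r * u r + v r * v r))%R) s
    ((a * u s + b * v s) / (u s * u s + v s * v s))%R.
Proof.
intros Hs Hu Hv.
assert (P : (0 < u s * u s + v s * v s)%R) by nra.
assert (Q := sqrt_lt_R0 _ P).
auto_derive.
- repeat split; try (eexists; eassumption); assumption.
- replace (Derive (fun x => u x) s) with a by (symmetry; now apply is_derive_unique).
  replace (Derive (fun x => v x) s) with b by (symmetry; now apply is_derive_unique).
  set (q := sqrt _) in *.
  replace (u s * u s + v s * v s)%R with (q * q)%R by (apply sqrt_sqrt; lra).
  field; lra.
Qed.

Lemma is_derive_atan_ratio (u v : R -> R) (s a b : R) : (0 < u s)%R ->
  is_derive u s a -> is_derive v s b ->
  is_derive (fun r => atan (v r / u r)%R) s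
    ((b * u s - a * v s) / (u s * u s + v s * v s))%R.
Proof.
intros Hs Hu Hv.
assert (P : (0 < u s * u s + v s * v s)%R) by nra.
assert (P' : (0 < u s ^ 2 + v s ^ 2)%R) by nra.
auto_derive.
- repeat split; try (eexists; eassumption); lra.
- replace (Derive (fun x => u x) s) with a by (symmetry; now apply is_derive_unique).
  replace (Derive (fun x => v x) s) with b by (symmetry; now apply is_derive_unique).
  unfold Rsqr; field; repeat split; lra.
Qed.

Lemma is_Cderive_Clog (f : R -> C) (s : R) (l : C) : (0 < Re (f s))%R ->
  is_Cderive f s l -> is_Cderive (fun r => Clog (f r)) s (l / f s).
Proof.
intros Hs [F1 F2]; split; simpl.
- apply is_derive_ext with (fun r => ln (sqrt (Re (f r) * Re (f r) + Im (f r) * Im (f r)))).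
  { intros r; unfold Cmod, Re, Im; do 2 f_equal; simpl; ring. }
  generalize (is_derive_ln_sqrt_sum_squares _ _ _ _ _ Hs F1 F2).
  apply is_derive_eq; unfold Re, Im in *; simpl; field; nra.
(* The arctangent formula needs a positive real part, which persists near [s] by continuity. *)
- apply is_derive_ext_loc with (fun r => atan (Im (f r) / Re (f r))).
  { assert (Cont : continuous (fun r => Re (f r)) s)
      by (apply (ex_derive_continuous (V := R_NormedModule)); now exists (Re l)).
    refine (filter_imp (fun r => (0 < Re (f r))%R) _ _
      (Cont (fun x => (0 < x)%R) (open_gt 0%R _ Hs))).
    intros r Hr; symmetry; now apply Carg_atan. }
  generalize (is_derive_atan_ratio _ _ _ _ _ Hs F1 F2).
  apply is_derive_eq; unfold Re, Im in *; simpl; field; nra.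
Qed.

Lemma Re_pos_neq_0 (z : C) : (0 < Re z)%R -> z <> 0.
Proof. intros H E; rewrite E in H; simpl in H; lra. Qed.

Lemma is_Cderive_Cpower (f : R -> C) (w : C) (s : R) (l : C) : (0 < Re (f s))%R ->
  is_Cderive f s l ->
  is_Cderive (fun r => Cpower (f r) w) s (w * l * Cpower (f s) (w - 1)).
Proof.
intros Hs F.
eapply is_Cderive_eq.
- apply is_Cderive_Cexp, is_Cderive_mult;
    [apply is_Cderive_const | now apply is_Cderive_Clog; [|eassumption]].
- cbv beta; change (Cexp (w * Clog (f s))) with (Cpower (f s) w).
  rewrite (Cpower_minus_1 _ w) by assumption.
  apply Re_pos_neq_0 in Hs. field; assumption.
Qed.

Lemma is_Cderive_affine_power (c w : C) (s : R) : (0 < Re (1 - s * c))%R ->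
  is_Cderive (fun r => Cpower (1 - r * c) w) s (- w * c * Cpower (1 - s * c) (w - 1)).
Proof.
intros Hs. eapply is_Cderive_eq.
- apply is_Cderive_Cpower; [assumption|].
  apply is_Cderive_ext with (fun r => 1 + - c * r); [intros r; ring|].
  apply is_Cderive_plus; [apply is_Cderive_const|].
  apply is_Cderive_mult; [apply is_Cderive_const | apply is_Cderive_RtoC].
- cbv beta; ring.
Qed.

(** * Integrals of complex functions over a real interval *)

(** Fundamental theorem of calculus in each component; differentiability of [df] serves to make the
    integrand continuous. *)
Lemma is_Cderive_is_RInt (f df : R -> C) (a b : R) : (a <= b)%R ->
  (forall s, (a <= s <= b)%R -> is_Cderive f s (df s)) ->
  (forall s, (a <= s <= b)%R -> exists l, is_Cderive df s l) ->
  is_RInt (V := C_R_NormedModule) df a b (f b - f a).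
Proof.
intros Hab Hf Hdf.
apply (is_RInt_fct_extend_pair (U := R_NormedModule) (V := R_NormedModule)).
- refine (is_RInt_derive (fun r => Re (f r)) (fun r => Re (df r)) a b _ _);
    rewrite Rmin_left, Rmax_right by assumption; intros s Hs.
  + now apply Hf.
  + destruct (Hdf s Hs) as [l [H _]].
    apply (ex_derive_continuous (V := R_NormedModule)); now exists (Re l).
- refine (is_RInt_derive (fun r => Im (f r)) (fun r => Im (df r)) a b _ _);
    rewrite Rmin_left, Rmax_right by assumption; intros s Hs.
  + now apply Hf.
  + destruct (Hdf s Hs) as [l [_ H]].
    apply (ex_derive_continuous (V := R_NormedModule)); now exists (Im l).
Qed.

Lemma ex_RInt_of_is_Cderive (f : R -> C) (a b : R) : (a <= b)%R ->
  (forall s, (a <= s <= b)%R -> exists l, is_Cderive f s l) ->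
  exists I, is_RInt (V := C_R_NormedModule) f a b I.
Proof.
intros Hab Hf.
destruct (ex_RInt_continuous (fun r => Re (f r)) a b) as [I1 H1].
{ rewrite Rmin_left, Rmax_right by assumption; intros s Hs.
  destruct (Hf s Hs) as [l [H _]].
  apply (ex_derive_continuous (V := R_NormedModule)); now exists (Re l). }
destruct (ex_RInt_continuous (fun r => Im (f r)) a b) as [I2 H2].
{ rewrite Rmin_left, Rmax_right by assumption; intros s Hs.
  destruct (Hf s Hs) as [l [_ H]].
  apply (ex_derive_continuous (V := R_NormedModule)); now exists (Im l). }
exists (I1, I2).
now apply (is_RInt_fct_extend_pair (U := R_NormedModule) (V := R_NormedModule)).
Qed.

(** A complex factor mixes the components: each component of [J] combines both real integrals of
    [f], and uniqueness of real integrals concludes. *)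
Lemma is_RInt_Cmult_unique (f : R -> C) (a b : R) (c I J : C) :
  is_RInt (V := C_R_NormedModule) f a b I ->
  is_RInt (V := C_R_NormedModule) (fun r => c * f r) a b J ->
  J = c * I.
Proof.
intros HI HJ.
assert (I1 := is_RInt_fct_extend_fst (U := R_NormedModule) (V := R_NormedModule) _ _ _ _ HI).
assert (I2 := is_RInt_fct_extend_snd (U := R_NormedModule) (V := R_NormedModule) _ _ _ _ HI).
assert (J1 := is_RInt_fct_extend_fst (U := R_NormedModule) (V := R_NormedModule) _ _ _ _ HJ).
assert (J2 := is_RInt_fct_extend_snd (U := R_NormedModule) (V := R_NormedModule) _ _ _ _ HJ).
apply injective_projections.
- refine (eq_trans (eq_sym (is_RInt_unique (V := R_CompleteNormedModule) _ _ _ _ J1)) _).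
  apply (is_RInt_unique (V := R_CompleteNormedModule)).
  exact (is_RInt_minus _ _ _ _ _ _ (is_RInt_scal _ _ _ (fst c) _ I1)
           (is_RInt_scal _ _ _ (snd c) _ I2)).
- refine (eq_trans (eq_sym (is_RInt_unique (V := R_CompleteNormedModule) _ _ _ _ J2)) _).
  apply (is_RInt_unique (V := R_CompleteNormedModule)).
  exact (is_RInt_plus _ _ _ _ _ _ (is_RInt_scal _ _ _ (fst c) _ I2)
           (is_RInt_scal _ _ _ (snd c) _ I1)).
Qed.

(** * Subgeometric growth for perturbed recurrences *)

Lemma eventually_decreasing_bounded (N : nat) (u : nat -> R) :
  (forall n, (N <= n)%nat -> (u (S n) <= u n)%R) ->
  exists M, forall n, (u n <= M)%R.
Proof.
revert u; induction N as [|N IH]; intros u Hu.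
- exists (u 0%nat); intros n; induction n as [|n IHn]; [lra|].
  generalize (Hu n (Nat.le_0_l n)); lra.
- destruct (IH (fun n => u (S n))) as [M HM].
  { intros n Hn; apply Hu; lia. }
  exists (Rmax (u 0%nat) M); intros [|n]; [apply Rmax_l|].
  apply Rle_trans with (1 := HM n), Rmax_r.
Qed.

(** The terms [u n * r ^ n] grow by a factor at most [(1 + L / (n + 1)) r], which tends to [r < 1],
    so they eventually decrease. *)
Lemma subgeometric_of_ratio (L r : R) (u : nat -> R) :
  (0 <= L)%R -> (0 <= r < 1)%R -> (forall n, (0 <= u n)%R) ->
  (forall n, (u (S n) <= (1 + L / (INR n + 1)) * u n)%R) ->
  exists M, forall n, (u n * r ^ n <= M)%R.
Proof.
intros HL Hr Hu Hrec.
(* The factor is at most 1 exactly when [L r <= (1 - r) (n + 1)], whence this threshold. *)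
destruct (INR_unbounded (L * r / (1 - r))) as [N HN].
apply (eventually_decreasing_bounded N); intros n Hn.
apply le_INR in Hn.
assert (Hp : (0 < INR n + 1)%R) by (generalize (pos_INR n); lra).
assert (E : ((1 + L / (INR n + 1)) * r <= 1)%R).
{ apply Rmult_lt_compat_r with (r := (1 - r)%R) in HN; [|lra].
  replace (L * r / (1 - r) * (1 - r))%R with (L * r)%R in HN by (field; lra).
  apply Rmult_le_reg_r with (1 := Hp).
  replace ((1 + L / (INR n + 1)) * r * (INR n + 1))%R
    with (r * (INR n + 1) + L * r)%R by (field; lra).
  nra. }
simpl. assert (Hrn : (0 <= r ^ n)%R) by (apply pow_le; lra).
assert (Hun := Hu n). assert (Hq := Hrec n).
apply Rle_trans with ((1 + L / (INR n + 1)) * u n * (r * r ^ n))%R.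
- apply Rmult_le_compat_r; [|assumption]. apply Rmult_le_pos; lra.
- replace ((1 + L / (INR n + 1)) * u n * (r * r ^ n))%R
    with ((1 + L / (INR n + 1)) * r * (u n * r ^ n))%R by ring.
  rewrite <- (Rmult_1_l (u n * r ^ n)) at 2.
  apply Rmult_le_compat_r; [|assumption]. now apply Rmult_le_pos.
Qed.

(* The two first-order differences [y (n+1) - a y n] and [y (n+1) - b y n] each
   evolve by a unimodular factor up to the O(1/n) perturbation, and since
   [a <> b] they control [y n] and [y (n+1)]. *)
Lemma perturbed_recurrence_subgeometric (a b : C) (K r : R) (y : nat -> C) :
  Cmod a = 1%R -> Cmod b = 1%R -> a <> b -> (0 <= r < 1)%R -> (0 <= K)%R ->
  (forall n, (Cmod (y (S (S n)) - (a + b) * y (S n) + a * b * y n)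
     <= K / (INR n + 1) * (Cmod (y (S n)) + Cmod (y n)))%R) ->
  exists M, forall n, (Cmod (y n) * r ^ n <= M)%R.
Proof.
intros Ha Hb Hab Hr HK Hy.
set (v := fun n => y (S n) - a * y n).
set (w := fun n => y (S n) - b * y n).
set (T := fun n => (Cmod (v n) + Cmod (w n))%R).
set (d := Cmod (b - a)).
assert (Hd : (0 < d)%R).
{ apply Cmod_gt_0; intros E; apply Hab. apply Ceq_minus in E; now symmetry. }
assert (HT : forall n, (0 <= T n)%R)
  by (intros n; unfold T; generalize (Cmod_ge_0 (v n)) (Cmod_ge_0 (w n)); lra).
assert (Hy0 : forall n, (Cmod (y n) <= T n / d)%R).
{ intros n. apply Rmult_le_reg_r with (1 := Hd).
  replace (T n / d * d)%R with (T n) by (field; lra).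
  unfold d; rewrite <- Cmod_mult.
  replace (y n * (b - a)) with (v n + - w n) by (unfold v, w; ring).
  unfold T; rewrite <- (Cmod_opp (w n)); apply Cmod_triangle. }
assert (Hy1 : forall n, (Cmod (y (S n)) <= T n + T n / d)%R).
{ intros n. replace (y (S n)) with (v n + a * y n) by (unfold v; ring).
  eapply Rle_trans; [apply Cmod_triangle|]. rewrite Cmod_mult, Ha.
  generalize (Hy0 n) (Cmod_ge_0 (w n)); unfold T; lra. }
(* The error enters both [v] and [w], hence the 2; the bounds [Hy0] and [Hy1] sum to at most
   [(1 + 2 / d) T n]. *)
set (L := (2 * K * (1 + 2 / d))%R).
assert (Hd' : (0 < / d)%R) by now apply Rinv_0_lt_compat.
assert (HL : (0 <= L)%R) by (unfold L, Rdiv; apply Rmult_le_pos; lra).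
destruct (subgeometric_of_ratio L r T HL Hr HT) as [M HM].
{ intros n.
  assert (Hp : (0 < INR n + 1)%R) by (generalize (pos_INR n); lra).
  assert (HKn : (0 <= K / (INR n + 1))%R)
    by (unfold Rdiv; apply Rmult_le_pos; [assumption | left; now apply Rinv_0_lt_compat]).
  set (e := y (S (S n)) - (a + b) * y (S n) + a * b * y n) in *.
  assert (He : (Cmod e <= K / (INR n + 1) * ((1 + 2 / d) * T n))%R).
  { eapply Rle_trans; [apply Hy|]. apply Rmult_le_compat_l; [assumption|].
    generalize (Hy0 n) (Hy1 n); unfold Rdiv; lra. }
  assert (Hv : (Cmod (v (S n)) <= Cmod (v n) + Cmod e)%R).
  { replace (v (S n)) with (b * v n + e) by (unfold v, e; ring).
    eapply Rle_trans; [apply Cmod_triangle|]. rewrite Cmod_mult, Hb; lra. }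
  assert (Hw : (Cmod (w (S n)) <= Cmod (w n) + Cmod e)%R).
  { replace (w (S n)) with (a * w n + e) by (unfold w, e; ring).
    eapply Rle_trans; [apply Cmod_triangle|]. rewrite Cmod_mult, Ha; lra. }
  replace ((1 + L / (INR n + 1)) * T n)%R
    with (T n + 2 * (K / (INR n + 1) * ((1 + 2 / d) * T n)))%R
    by (unfold L; field; lra).
  unfold T in *; lra. }
exists (M / d)%R; intros n.
apply Rle_trans with (T n / d * r ^ n)%R.
- apply Rmult_le_compat_r; [apply pow_le; lra | apply Hy0].
- unfold Rdiv. replace (T n * / d * r ^ n)%R with (T n * r ^ n * / d)%R by ring.
  apply Rmult_le_compat_r; [lra | apply HM].
Qed.

(** * Power series with complex coefficients at real points *)

(** The point [t] of the disc will be absorbed into the coefficients [y n * t ^ n], so only real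
    arguments occur and two real power series suffice. *)
Definition CPSeries (z : nat -> C) (s : R) : C :=
  (PSeries (fun n => Re (z n)) s, PSeries (fun n => Im (z n)) s).

Definition CPS_derive (z : nat -> C) (n : nat) : C := (INR n + 1) * z (S n).

Lemma is_series_C (u : nat -> C) (l : C) :
  is_series (fun n => Re (u n)) (Re l) -> is_series (fun n => Im (u n)) (Im l) ->
  is_series (V := C_NormedModule) u l.
Proof.
intros H1 H2.
assert (E : forall n, sum_n (G := C_AbelianGroup) u n =
   (sum_n (fun n => Re (u n)) n, sum_n (fun n => Im (u n)) n)).
{ induction n as [|n IH].
  - rewrite !sum_O; now destruct (u 0%nat).
  - rewrite !sum_Sn, IH; reflexivity. }
apply filterlim_locally; intros eps.
generalize (filter_and _ _ (proj1 (filterlim_locally _ _) H1 eps)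
  (proj1 (filterlim_locally _ _) H2 eps)).
apply filter_imp; intros n Hn.
rewrite E; exact Hn.
Qed.

Lemma pow_n_RtoC (s : R) (n : nat) : pow_n (K := C_Ring) (RtoC s) n = RtoC (s ^ n).
Proof.
induction n as [|n IH]; [reflexivity|].
simpl pow_n; rewrite IH; unfold mult; simpl; now rewrite <- RtoC_mult.
Qed.

Lemma is_pseries_CPSeries (z : nat -> C) (s : R) :
  Rbar_lt (Rabs s) (CV_radius (fun n => Re (z n))) ->
  Rbar_lt (Rabs s) (CV_radius (fun n => Im (z n))) ->
  is_pseries (V := C_NormedModule) z (RtoC s) (CPSeries z s).
Proof.
intros H1 H2; apply CV_radius_inside, PSeries_correct in H1, H2.
apply is_series_C.
- eapply is_series_ext; [|exact H1]; intros n; simpl.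
  rewrite pow_n_RtoC, pow_n_pow; unfold scal; simpl; unfold mult; simpl; unfold Re; simpl; ring.
- eapply is_series_ext; [|exact H2]; intros n; simpl.
  rewrite pow_n_RtoC, pow_n_pow; unfold scal; simpl; unfold mult; simpl; unfold Im; simpl; ring.
Qed.

Lemma CPS_derive_Re (z : nat -> C) (n : nat) :
  Re (CPS_derive z n) = PS_derive (fun n => Re (z n)) n.
Proof. unfold CPS_derive, PS_derive; rewrite S_INR; simpl; unfold Re; ring. Qed.

Lemma CPS_derive_Im (z : nat -> C) (n : nat) :
  Im (CPS_derive z n) = PS_derive (fun n => Im (z n)) n.
Proof. unfold CPS_derive, PS_derive; rewrite S_INR; simpl; unfold Im; ring. Qed.

Lemma is_Cderive_CPSeries (z : nat -> C) (s : R) :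
  Rbar_lt (Rabs s) (CV_radius (fun n => Re (z n))) ->
  Rbar_lt (Rabs s) (CV_radius (fun n => Im (z n))) ->
  is_Cderive (CPSeries z) s (CPSeries (CPS_derive z) s).
Proof.
intros H1 H2; split; simpl.
- rewrite (PSeries_ext _ _ _ (CPS_derive_Re z)); now apply is_derive_PSeries.
- rewrite (PSeries_ext _ _ _ (CPS_derive_Im z)); now apply is_derive_PSeries.
Qed.

(** There is room between [|t|] and 1: some [rho > 1] still has [|t| rho < 1], and the growth bound
    at [|t| rho] makes [u n * rho ^ n] bounded. *)
Lemma CV_radius_gt_1 (u : nat -> R) (v : nat -> C) (t : C) :
  (forall r, (0 <= r < 1)%R -> exists M, forall n, (Cmod (v n) * r ^ n <= M)%R) ->
  (Cmod t < 1)%R ->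
  (forall n, (Rabs (u n) <= Cmod (v n * Cpow t n))%R) ->
  Rbar_lt 1 (CV_radius u).
Proof.
intros Hv Ht Hu. assert (Ht0 := Cmod_ge_0 t).
(* Since [|t| < 1], both [2 > 1 + |t|] and [2 |t| < 1 + |t|] hold. *)
set (rho := (2 / (1 + Cmod t))%R).
assert (H1 : (1 < rho)%R).
{ apply Rmult_lt_reg_r with (1 + Cmod t)%R; [lra|]. unfold rho; field_simplify; lra. }
assert (H2 : (Cmod t * rho < 1)%R).
{ apply Rmult_lt_reg_r with (1 + Cmod t)%R; [lra|]. unfold rho; field_simplify; lra. }
destruct (Hv (Cmod t * rho)%R) as [M HM].
{ split; [apply Rmult_le_pos; lra | assumption]. }
apply Rbar_lt_le_trans with rho; [exact H1|].
apply CV_radius_bounded; exists M; intros n.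
rewrite Rabs_mult, (Rabs_pos_eq (rho ^ n)) by (apply pow_le; lra).
apply Rle_trans with (2 := HM n).
rewrite Rpow_mult_distr, <- Rmult_assoc.
apply Rmult_le_compat_r; [apply pow_le; lra|].
now rewrite <- Cmod_pow, <- Cmod_mult.
Qed.

(** Turns the vanishing of all higher coefficients into an identity between sums, by uniqueness of
    limits. *)
Lemma is_pseries_constant (z : nat -> C) (x : C) :
  (forall n, z (S n) = 0) -> is_pseries (V := C_NormedModule) z x (z 0%nat).
Proof.
intros Hz.
assert (E : forall n, sum_n (G := C_AbelianGroup)
    (fun k => scal (V := C_NormedModule) (pow_n (K := C_Ring) x k) (z k)) n = z 0%nat).
{ induction n as [|n IH].
  - rewrite sum_O; unfold scal; simpl; unfold mult, one; simpl; ring.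
  - rewrite sum_Sn, IH, Hz; unfold scal, plus; simpl; unfold mult; simpl; ring. }
unfold is_pseries, is_series.
eapply filterlim_ext; [intros n; symmetry; apply E|apply filterlim_const].
Qed.

(** * The unimodular numbers [e^(i phi)] and [e^(-i phi)] *)

Lemma Cexp_Ci (phi : R) : Cexp (Ci * phi) = cos phi + Ci * sin phi.
Proof.
unfold Cexp; simpl.
replace (0 * phi - 1 * 0)%R with 0%R by ring.
replace (0 * 0 + 1 * phi)%R with phi by ring.
rewrite exp_0; apply injective_projections; simpl; ring.
Qed.

Lemma Cexp_opp_Ci (phi : R) : Cexp (- (Ci * phi)) = cos phi - Ci * sin phi.
Proof.
replace (- (Ci * phi)) with (Ci * (- phi)%R) by (rewrite RtoC_opp; ring).
rewrite Cexp_Ci, cos_neg, sin_neg, RtoC_opp; ring.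
Qed.

Lemma Ci_sqr : Ci * Ci = - 1.
Proof. apply injective_projections; simpl; ring. Qed.

Lemma Cmod_Cexp (z : C) : Cmod (Cexp z) = exp (Re z).
Proof.
unfold Cmod, Cexp; simpl.
replace (_ + _)%R with (exp (Re z) * exp (Re z))%R.
- apply sqrt_square, Rlt_le, exp_pos.
- generalize (sin2_cos2 (Im z)); unfold Rsqr; intros H.
  transitivity (exp (Re z) * exp (Re z) *
    (sin (Im z) * sin (Im z) + cos (Im z) * cos (Im z)))%R; [rewrite H|]; ring.
Qed.

Lemma Cmod_Cexp_Ci (phi : R) : Cmod (Cexp (Ci * phi)) = 1%R.
Proof. rewrite Cmod_Cexp; simpl; rewrite <- exp_0; f_equal; ring. Qed.

Lemma Cmod_Cexp_opp_Ci (phi : R) : Cmod (Cexp (- (Ci * phi))) = 1%R.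
Proof. rewrite Cmod_Cexp; simpl; rewrite <- exp_0; f_equal; ring. Qed.

Lemma Re_one_minus_pos (z : C) : (Cmod z < 1)%R -> (0 < Re (1 - z))%R.
Proof.
intros Hz; generalize (re_le_Cmod z) (Rle_abs (Re z)); simpl; unfold Re; lra.
Qed.

(** * Growth and differential equation for the Meixner-Pollaczek recurrence *)

Lemma Meixner_Pollaczek_subgeometric (lambda phi : R) (x : C) (y : nat -> C)
  (hphi : (0 < phi < PI)%R)
  (hrec : forall n : nat, (1 <= n)%nat ->
     2 * (x * sin phi + (INR n + lambda) * cos phi) * y n
     = (INR n + 1) * y (n + 1)%nat + (INR n + 2 * lambda - 1) * y (n - 1)%nat) :
  forall r, (0 <= r < 1)%R -> exists M, forall n, (Cmod (y n) * r ^ n <= M)%R.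
Proof.
intros r Hr.
(* With the recurrence at index [n + 1] solved for [(n + 2) y_(n+2)], the coefficients of [y_(n+1)]
   and [y_n] are [2 (n + 2) cos phi + k1] and [-(n + 2) + k2]. Division by [n + 2] leaves the
   constant-coefficient recurrence plus an O(1/n) error. *)
set (k1 := 2 * (x * sin phi + (lambda - 1) * cos phi)).
set (k2 := - (2 * (lambda - 1))).
apply (perturbed_recurrence_subgeometric (Cexp (Ci * phi)) (Cexp (- (Ci * phi)))
  (Cmod k1 + Cmod k2)); auto using Cmod_Cexp_Ci, Cmod_Cexp_opp_Ci.
- rewrite Cexp_Ci, Cexp_opp_Ci; intros E; apply (f_equal snd) in E; simpl in E.
  generalize (sin_gt_0 phi (proj1 hphi) (proj2 hphi)); lra.
- generalize (Cmod_ge_0 k1) (Cmod_ge_0 k2); lra.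
- intros n.
  assert (H := hrec (S n) (le_n_S _ _ (Nat.le_0_l n))).
  replace (S n + 1)%nat with (S (S n)) in H by lia.
  replace (S n - 1)%nat with n in H by lia.
  rewrite S_INR, RtoC_plus in H.
  assert (Hp : (0 < INR n + 1 + 1)%R) by (generalize (pos_INR n); lra).
  assert (Hp0 : RtoC (INR n) + 1 + 1 <> 0).
  { rewrite <- !RtoC_plus; intros E; apply RtoC_inj in E; lra. }
  assert (E : y (S (S n)) - (Cexp (Ci * phi) + Cexp (- (Ci * phi))) * y (S n)
      + Cexp (Ci * phi) * Cexp (- (Ci * phi)) * y n
      = (k1 * y (S n) + k2 * y n) / (RtoC (INR n) + 1 + 1)).
  { rewrite <- Cexp_plus, Cplus_opp_r, Cexp_0, Cexp_Ci, Cexp_opp_Ci.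
    replace (y (S (S n))) with ((RtoC (INR n) + 1 + 1) * y (S (S n)) / (RtoC (INR n) + 1 + 1))
      by (field; assumption).
    replace ((RtoC (INR n) + 1 + 1) * y (S (S n))) with
      (2 * (x * sin phi + (INR n + 1 + lambda) * cos phi) * y (S n)
       - (INR n + 1 + 2 * lambda - 1) * y n) by (rewrite H; ring).
    unfold k1, k2; field; assumption. }
  rewrite E, Cmod_div by assumption.
  rewrite <- !RtoC_plus, Cmod_R, Rabs_pos_eq by lra.
  assert (T := Cmod_triangle (k1 * y (S n)) (k2 * y n)).
  rewrite !Cmod_mult in T.
  assert (Hn := pos_INR n).
  assert (A1 := Cmod_ge_0 k1); assert (A2 := Cmod_ge_0 k2).
  assert (A3 := Cmod_ge_0 (y (S n))); assert (A4 := Cmod_ge_0 (y n)).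
  apply Rle_trans with ((Cmod k1 + Cmod k2) * (Cmod (y (S n)) + Cmod (y n)) / (INR n + 1 + 1))%R.
  + apply Rmult_le_compat_r; [left; now apply Rinv_0_lt_compat|]. nra.
  + unfold Rdiv.
    replace ((Cmod k1 + Cmod k2) * / (INR n + 1) * (Cmod (y (S n)) + Cmod (y n)))%R
      with ((Cmod k1 + Cmod k2) * (Cmod (y (S n)) + Cmod (y n)) * / (INR n + 1))%R by ring.
    apply Rmult_le_compat_l; [apply Rmult_le_pos; lra|].
    apply Rinv_le_contravar; lra.
Qed.

(* The recurrence for [z n = y n * t ^ n], read off coefficientwise, is a linear
   first-order equation for the generating function along the segment [0, t]. *)
Lemma Meixner_Pollaczek_ode (lambda phi s : R) (x t : C) (z : nat -> C)
  (H1 : Rbar_lt (Rabs s) (CV_radius (fun n => Re (z n))))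
  (H2 : Rbar_lt (Rabs s) (CV_radius (fun n => Im (z n))))
  (hrec : forall n : nat,
     2 * t * (x * sin phi + (INR n + 1 + lambda) * cos phi) * z (S n)
     = (INR n + 1 + 1) * z (S (S n)) + t * t * (INR n + 2 * lambda) * z n) :
  (1 - 2 * s * t * cos phi + s * s * t * t) * CPSeries (CPS_derive z) s
  - (2 * t * (x * sin phi + lambda * cos phi) - 2 * lambda * s * t * t) * CPSeries z s
  = z 1%nat - 2 * t * (x * sin phi + lambda * cos phi) * z 0%nat.
Proof.
set (D := CPSeries (CPS_derive z) s); set (F := CPSeries z s).
assert (HF : is_pseries (V := C_NormedModule) z (RtoC s) F)
  by now apply is_pseries_CPSeries.
assert (HD : is_pseries (V := C_NormedModule) (CPS_derive z) (RtoC s) D).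
{ apply is_pseries_CPSeries.
  - now rewrite (CV_radius_ext _ _ (CPS_derive_Re z)), CV_radius_derive.
  - now rewrite (CV_radius_ext _ _ (CPS_derive_Im z)), CV_radius_derive. }
assert (Hcomm : forall c : C, mult (RtoC s : C_AbsRing) c = mult c (RtoC s : C_AbsRing))
  by (intros c; apply Cmult_comm).
assert (Hs := fun c u l => is_pseries_scal (V := C_NormedModule) c u (RtoC s) l (Hcomm c)).
assert (HsD := is_pseries_incr_1 _ _ _ HD).
assert (HssD := is_pseries_incr_1 _ _ _ HsD).
assert (HsF := is_pseries_incr_1 _ _ _ HF).
set (k := - (2 * t * (x * sin phi + lambda * cos phi))).
(* The left-hand side expanded as a power series in [s]: the terms in [D], [s D], [s^2 D], [F] and
   [s F]. *)
assert (HT := is_pseries_plus _ _ _ _ _ HD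
  (is_pseries_plus _ _ _ _ _ (Hs (- (2 * t * cos phi)) _ _ HsD)
  (is_pseries_plus _ _ _ _ _ (Hs (t * t) _ _ HssD)
  (is_pseries_plus _ _ _ _ _ (Hs k _ _ HF)
    (Hs (2 * lambda * t * t) _ _ HsF))))).
set (c := PS_plus _ _) in HT.
assert (Hc0 : c 0%nat = z 1%nat + k * z 0%nat).
{ unfold c, PS_plus, PS_scal, PS_incr_1, CPS_derive; simpl.
  unfold plus, scal, zero; simpl; unfold mult; simpl; ring. }
assert (HcS : forall n, (c (S n) : C) = 0).
{ intros n.
  transitivity ((INR n + 1 + 1) * z (S (S n)) + t * t * (INR n + 2 * lambda) * z n
     - 2 * t * (x * sin phi + (INR n + 1 + lambda) * cos phi) * z (S n));
    [|rewrite hrec; ring].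
  unfold c, PS_plus, PS_scal, PS_incr_1, CPS_derive.
  unfold plus, scal, zero; cbn -[INR]; unfold mult; cbn -[INR].
  (* The coefficient of [s^(n+1)] in [s^2 D] is [n z_n]; at [n = 0] it is the zero put in front by
     [PS_incr_1], hence the case split. *)
  destruct n as [|n]; unfold k; rewrite ?S_INR; simpl INR; rewrite ?RtoC_plus; ring. }
assert (HU := filterlim_locally_unique _ _ _ HT (is_pseries_constant c (RtoC s) HcS)).
rewrite Hc0 in HU.
unfold plus, scal in HU; simpl in HU; unfold mult in HU; simpl in HU.
unfold k in HU.
transitivity (z 1%nat + - (2 * t * (x * sin phi + lambda * cos phi)) * z 0%nat); [|ring].
rewrite <- HU; ring.
Qed.

(** * The formula, by integration along the segment *)

Theorem mainTheorem6 (lambda phi : R) (x : C) (y : nat -> C)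
  (hlambda : (0 < lambda)%R)
  (hphi : (0 < phi < PI)%R)
  (hrec : forall n : nat, (1 <= n)%nat ->
     2 * (x * sin phi + (INR n + lambda) * cos phi) * y n
     = (INR n + 1) * y (n + 1)%nat + (INR n + 2 * lambda - 1) * y (n - 1)%nat) :
  forall t : C, (Cmod t < 1)%R ->
  exists Y J : C,
    @is_pseries C_AbsRing C_NormedModule y t Y /\
    is_CInt
      (fun u : C =>
         Cpower (1 - u * Cexp (Ci * phi)) (lambda - Ci * x - 1) *
         Cpower (1 - u * Cexp (- (Ci * phi))) (lambda + Ci * x - 1))
      0 t J /\
    Cpower (1 - t * Cexp (Ci * phi)) (lambda - Ci * x) *
    Cpower (1 - t * Cexp (- (Ci * phi))) (lambda + Ci * x) * Y
    = y 0%nat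
      + (y 1%nat - 2 * x * sin phi * y 0%nat - 2 * lambda * cos phi * y 0%nat) * J.
Proof.
intros t Ht.
(* With these coefficients [F s] is the generating function at [s t], so [Y] is the value at
   [s = 1]. *)
set (z := fun n => y n * Cpow t n).
assert (Hy := Meixner_Pollaczek_subgeometric _ _ _ _ hphi hrec).
(* A radius strictly above 1 makes the endpoint [s = 1] interior, giving both convergence and
   differentiability there. *)
assert (R1 : Rbar_lt 1 (CV_radius (fun n => Re (z n)))).
{ apply (CV_radius_gt_1 _ y t Hy Ht); intros n; apply re_le_Cmod. }
assert (R2 : Rbar_lt 1 (CV_radius (fun n => Im (z n)))).
{ apply (CV_radius_gt_1 _ y t Hy Ht); intros n.
  apply Rle_trans with (2 := Rmax_Cmod _), Rmax_r. }
assert (Rs : forall (s : R) (r : Rbar), (0 <= s <= 1)%R -> Rbar_lt 1 r -> Rbar_lt (Rabs s) r).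
{ intros s r Hs; apply Rbar_le_lt_trans; simpl; rewrite Rabs_pos_eq; lra. }
set (F := CPSeries z).
set (a := Cexp (Ci * phi)); set (b := Cexp (- (Ci * phi))).
set (p := lambda - Ci * x); set (q := lambda + Ci * x).
assert (Hpos : forall (w : C) (s : R), Cmod w = 1%R -> (0 <= s <= 1)%R ->
    (0 < Re (1 - s * (t * w)))%R).
{ intros w s Hw Hs; apply Re_one_minus_pos.
  rewrite !Cmod_mult, Hw, Cmod_R, Rabs_pos_eq by lra.
  generalize (Cmod_ge_0 t); nra. }
set (P := fun (w e : C) (s : R) => Cpower (1 - s * (t * w)) e).
set (c := y 1%nat - 2 * x * sin phi * y 0%nat - 2 * lambda * cos phi * y 0%nat).
(* The leading [t] is the factor [b - a] in [is_CInt], from [du = t ds]. *)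
set (g := fun s : R => t * (P a (p - 1) s * P b (q - 1) s)).
assert (dP : forall (w e : C) (s : R), Cmod w = 1%R -> (0 <= s <= 1)%R ->
  is_Cderive (P w e) s (- e * (t * w) * P w (e - 1) s)).
{ intros; apply is_Cderive_affine_power; auto. }
assert (Ha : Cmod a = 1%R) by apply Cmod_Cexp_Ci.
assert (Hb : Cmod b = 1%R) by apply Cmod_Cexp_opp_Ci.
assert (dg : forall s, (0 <= s <= 1)%R -> exists l, is_Cderive g s l).
{ intros s Hs; eexists. apply is_Cderive_mult; [apply is_Cderive_const|].
  now apply is_Cderive_mult; apply dP. }
assert (dG : forall s, (0 <= s <= 1)%R ->
  is_Cderive (fun s => P a p s * P b q s * F s) s (c * g s)).
{ intros s Hs. eapply is_Cderive_eq.
  - apply is_Cderive_mult; [apply is_Cderive_mult; apply dP; assumption|].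
    apply is_Cderive_CPSeries; auto.
  - cbv beta; fold (F s).
    assert (O := Meixner_Pollaczek_ode lambda phi s x t z (Rs _ _ Hs R1) (Rs _ _ Hs R2)).
    fold (F s) in O. set (D := CPSeries (CPS_derive z) s) in *.
    (* Lowering both exponents by one lets [P a (p - 1) s * P b (q - 1) s] be factored out of the
       derivative; what remains is the left-hand side of the differential equation times [t]-free
       powers. *)
    assert (Pa : P a p s = P a (p - 1) s * (1 - s * (t * a))) by (apply Cpower_minus_1; auto).
    assert (Pb : P b q s = P b (q - 1) s * (1 - s * (t * b))) by (apply Cpower_minus_1; auto).
    rewrite Pa, Pb.
    (* The remaining factor involves [a], [b], [p], [q] only through [a b], [a + b], [p a + q b] and
       [p + q]. *)
    assert (Eab : a * b = 1).
    { unfold a, b; now rewrite <- Cexp_plus, Cplus_opp_r, Cexp_0. }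
    assert (Esum : a + b = 2 * cos phi)
      by (unfold a, b; rewrite Cexp_Ci, Cexp_opp_Ci; ring).
    assert (Epq : p * a + q * b = 2 * (x * sin phi + lambda * cos phi)).
    { unfold a, b, p, q; rewrite Cexp_Ci, Cexp_opp_Ci.
      transitivity (2 * (lambda * cos phi - Ci * Ci * x * sin phi)); [ring|].
      rewrite Ci_sqr; ring. }
    assert (Espq : p + q = 2 * lambda) by (unfold p, q; ring).
    transitivity (P a (p - 1) s * P b (q - 1) s *
      ((1 - s * t * (a + b) + s * s * t * t * (a * b)) * D
       - (t * (p * a + q * b) - (p + q) * s * t * t * (a * b)) * F s)); [ring|].
    rewrite Eab, Esum, Epq, Espq.
    transitivity (P a (p - 1) s * P b (q - 1) s *
      ((1 - 2 * s * t * cos phi + s * s * t * t) * D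
       - (2 * t * (x * sin phi + lambda * cos phi) - 2 * lambda * s * t * t) * F s)); [ring|].
    (* As [z 1 = t * y 1], the right-hand side of the equation is [t * c], and this [t] is the one
       in [g]. *)
    rewrite O; [unfold g, c, z; simpl Cpow; ring|].
    (* The recurrence required for [z] is that for [y] at index [n + 1], multiplied by [t^(n+2)]. *)
    intros n; unfold z; simpl Cpow.
    assert (H := hrec (S n) (le_n_S _ _ (Nat.le_0_l n))).
    replace (S n + 1)%nat with (S (S n)) in H by lia.
    replace (S n - 1)%nat with n in H by lia.
    rewrite S_INR, RtoC_plus in H.
    transitivity (t * t * Cpow t n *
      (2 * (x * sin phi + (INR n + 1 + lambda) * cos phi) * y (S n))); [ring|].
    rewrite H; ring. }
destruct (ex_RInt_of_is_Cderive g 0 1 Rle_0_1 dg) as [J HJ].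
exists (F 1%R), J; split; [|split].
- assert (H : is_pseries (V := C_NormedModule) z (RtoC 1) (F 1%R))
    by (apply is_pseries_CPSeries; apply Rs; (assumption || lra)).
  unfold is_pseries in *; eapply is_series_ext; [|exact H]; intros n; simpl.
  rewrite pow_n_RtoC, pow1.
  replace (pow_n (K := C_Ring) t n) with (Cpow t n).
  + change (RtoC 1 * z n = Cpow t n * y n); unfold z; ring.
  + induction n as [|n IH]; [reflexivity|]. simpl; now rewrite IH.
- unfold is_CInt. eapply is_RInt_ext; [|exact HJ].
  intros s _. unfold g, P; fold a b p q.
  replace (0 + s * (t - 0)) with (s * t) by ring.
  replace (t - 0) with t by ring. now rewrite !(Cmult_assoc s t).
(* Integrating [dG] over [0, 1] gives the formula: the product equals [y 0] at [s = 0], where both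
   powers have base 1. *)
- assert (HG : is_RInt (V := C_R_NormedModule) (fun s => c * g s) 0 1
    (P a p 1%R * P b q 1%R * F 1%R - P a p 0%R * P b q 0%R * F 0%R)).
  { apply (is_Cderive_is_RInt (fun s => P a p s * P b q s * F s)); [lra|assumption|].
    intros s Hs; destruct (dg s Hs) as [l Hl]; eexists.
    apply is_Cderive_mult; [apply is_Cderive_const|exact Hl]. }
  apply (is_RInt_Cmult_unique _ _ _ _ _ _ HJ) in HG.
  assert (HP0 : forall w e, P w e 0%R = 1).
  { intros w e; unfold P. replace (1 - 0 * (t * w)) with (RtoC 1) by ring.
    apply Cpower_1_l. }
  assert (HP1 : forall w e, P w e 1%R = Cpower (1 - t * w) e).
  { intros w e; unfold P; f_equal; ring. }
  assert (HF0 : F 0%R = y 0%nat).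
  { unfold F, CPSeries; rewrite !PSeries_0; unfold z; simpl.
    apply injective_projections; simpl; ring. }
  rewrite !HP0, !HP1, HF0 in HG.
  rewrite <- HG; ring.
Qed.
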